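(* $\mathbf{bal}$ is a full reflective subcategory of $\mathbf{sbal}$.
   Context: All rings are commutative with $1$ and ring homomorphisms are unital. An $\ell$-ring is a ring $A$ with a lattice order such that $a\le b$ implies $a+c\le b+c$, and $0\le a,b$ implies $0\le ab$. It is bounded if for each $a$ there is $n\in\mathbb N$ with $-n\cdot1\le a\le n\cdot1$, and archimedean if whenever $na\le b$ for all $n\in\mathbb N$, then $a\le0$. An $\ell$-algebra is an $\ell$-ring that is an $\mathbb R$-algebra with $ra\ge0$ whenever $0\le a\in A$ and $0\le r\in\mathbb R$. $\mathbf{bal}$ is the category of bounded archimedean $\ell$-algebras and unital $\ell$-algebra homomorphisms. $\mathbb R^+=[0,\infty)$. An $\ell$-monoid is a commutative monoid $(S,+,0)$ with a lattice order such that for all $a,b,c$: $a\le b\iff a+c\le b+c$, $(a\vee b)+c=(a+c)\vee(b+c)$ and $(a\wedge b)+c=(a+c)\wedge(b+c)$. An $\ell$-monoid morphism is a lattice morphism preserving addition. Let $S^+=\{a\in S:a\ge0\}$. $S$ is an $\ell$-semialgebra if there is a commutative associative multiplication on $S^+$ with identity $1$; $a(b+c)=ab+ac$ for $a,b,c\in S^+$; $a\le b$ implies $ac\le bc$ for $a,b,c\in S^+$; and there is a unital $\ell$-monoid morphism $\rho:\mathbb R\to S$ preserving multiplication (of nonnegative elements). We write $r$ for $\rho(r)$ and $a-r$ for $a+\rho(-r)$. $S$ is bounded if for each $a$ there is $r\in\mathbb R^+$ with $-r\le a\le r$, and archimedean if $na+b\le nc+d$ for all $n\in\mathbb N$ implies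 $a\le c$. The $\mathbb R^+$-action is $ra=\rho(r)a$ for $a\in S^+$, and $ra=r(a+s)-rs$ for general $a\in S$, where $s\in\mathbb R^+$ is any element with $a+s\ge0$. $\mathbf{sbal}$ is the category of bounded archimedean $\ell$-semialgebras, with morphisms the unital $\ell$-monoid morphisms $\alpha:S\to T$ that preserve multiplication on $S^+$ and the $\mathbb R^+$-action. Each $A\in\mathbf{bal}$ is regarded as an object of $\mathbf{sbal}$ via its addition, its order, its multiplication restricted to $A^+$, and $\rho(r)=r\cdot1$. *)

(* Defs.v *)
From HB Require Import structures.
From mathcomp Require Import all_boot all_order all_algebra.
From mathcomp Require Import boolp reals.

Set Implicit Arguments.
Unset Strict Implicit.
Unset Printing Implicit Defensive.

Import Order.TTheory GRing.Theory Num.Theory.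
Local Open Scope ring_scope.

(* Lattice orders, axiomatized as [latticeType].  The library's [Order.Lattice]
   cannot be used: Hierarchy Builder rejects any new structure that joins it
   with [GRing.Nmodule], since [realDomainType], which already inherits from
   both, would have to be declared afterwards. *)
HB.mixin Record Choice_isLatOrdered T of Choice T := {
  latle : rel T;
  latmeet : T -> T -> T;
  latjoin : T -> T -> T;
  latlexx : reflexive latle;
  latle_anti : antisymmetric latle;
  latle_trans : transitive latle;
  latlexI : forall a b c, latle a (latmeet b c) = latle a b && latle a c;
  latleUx : forall a b c, latle (latjoin a b) c = latle a c && latle b c
}.

#[short(type="latOrdType")]
HB.structure Definition LatOrdered := {T of Choice T & Choice_isLatOrdered T}.

Notation "a ⊑ b" := (latle a b) (at level 70, no associativity) : ring_scope.
Notation "a ⊓ b" := (latmeet a b) (at level 48, left associativity) : ring_scope.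
Notation "a ⊔ b" := (latjoin a b) (at level 52, left associativity) : ring_scope.

#[short(type="latOrdNmodType")]
HB.structure Definition LatOrdNmodule := {S of GRing.Nmodule S & LatOrdered S}.

Section LatOrderedTheory.
Variable T : latOrdType.
Implicit Types a b c : T.

Lemma latle_meet_l a b : a ⊑ b -> a ⊓ b = a.
Proof.
move=> ab; apply/latle_anti; rewrite latlexI latlexx ab !andbT.
by have := latlexx (a ⊓ b); rewrite latlexI => /andP[].
Qed.

Lemma latmeet_le_l a b : a ⊓ b ⊑ a.
Proof. by have := latlexx (a ⊓ b); rewrite latlexI => /andP[]. Qed.

Lemma latmeet_le_r a b : a ⊓ b ⊑ b.
Proof. by have := latlexx (a ⊓ b); rewrite latlexI => /andP[]. Qed.

Lemma latle_join_l a b : a ⊑ a ⊔ b.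
Proof. by have := latlexx (a ⊔ b); rewrite latleUx => /andP[]. Qed.

Lemma latle_join_r a b : b ⊑ a ⊔ b.
Proof. by have := latlexx (a ⊔ b); rewrite latleUx => /andP[]. Qed.

Lemma latmeetC a b : a ⊓ b = b ⊓ a.
Proof.
by apply/latle_anti; rewrite !latlexI !latmeet_le_l !latmeet_le_r.
Qed.

Lemma latjoinC a b : a ⊔ b = b ⊔ a.
Proof.
by apply/latle_anti; rewrite !latleUx !latle_join_l !latle_join_r.
Qed.

Lemma latle_join_eq a b : a ⊑ b -> a ⊔ b = b.
Proof.
by move=> ab; apply/latle_anti; rewrite latleUx latlexx ab latle_join_r.
Qed.

End LatOrderedTheory.

#[non_forgetful_inheritance]
HB.instance Definition _ (R : realType) :=
  Choice_isLatOrdered.Build (Real.sort R)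
    (@lexx _ R) (@le_anti _ R) (@le_trans _ R) (@lexI _ R) (@leUx _ R).

(* The zero ring is allowed, hence [ComPzRing] and not [ComNzRing]. *)
HB.mixin Record ComPzRing_LatOrdered_isLRing A
    of GRing.ComPzRing A & LatOrdered A := {
  lring_lerD2r : forall a b c : A, a ⊑ b -> a + c ⊑ b + c;
  lring_mulr_ge0 : forall a b : A, 0 ⊑ a -> 0 ⊑ b -> 0 ⊑ a * b
}.

#[short(type="lringType")]
HB.structure Definition LRing :=
  {A of GRing.ComPzRing A & LatOrdered A &
        ComPzRing_LatOrdered_isLRing A}.

(* The library's R-algebras are nonzero rings, and it has no join of [Lmodule]
   and [PzRing] either, so the scalar multiplication is part of the mixin. *)
HB.mixin Record LRing_isLOrderAlgebra (R : realType) A of LRing A := {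
  rscale : R -> A -> A;
  rscaleA : forall r s a, rscale r (rscale s a) = rscale (r * s) a;
  rscale1 : forall a, rscale 1 a = a;
  rscaleDr : forall r a b, rscale r (a + b) = rscale r a + rscale r b;
  rscaleDl : forall r s a, rscale (r + s) a = rscale r a + rscale s a;
  rscaleAl : forall r a b, rscale r (a * b) = rscale r a * b;
  rscale_ge0 : forall r a, 0 ⊑ a -> 0 <= r -> 0 ⊑ rscale r a
}.

#[short(type="lorderAlgebraType")]
HB.structure Definition LOrderAlgebra (R : realType) :=
  {A of LRing A & LRing_isLOrderAlgebra R A}.

Notation "r •: a" := (rscale r a) (at level 40) : ring_scope.

Section RScale.
Variables (R : realType) (A : lorderAlgebraType R).
Implicit Types (r : R) (a : A).

Lemma rscale0 a : 0 •: a = 0 :> A.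
Proof. by apply: (@addrI _ (0 •: a)); rewrite -rscaleDl !addr0. Qed.

Lemma rscaleN r a : (- r) •: a = - (r •: a) :> A.
Proof. by apply: (@addrI _ (r •: a)); rewrite -rscaleDl !subrr rscale0. Qed.

Lemma rscale_nat n a : n%:R •: a = a *+ n :> A.
Proof.
elim: n => [|n IH]; first by rewrite rscale0.
by rewrite -natr1 rscaleDl IH rscale1 mulrSr.
Qed.

End RScale.

Definition lring_bounded (A : lringType) : Prop :=
  forall a : A, exists n : nat, - n%:R ⊑ a /\ a ⊑ n%:R.

Definition lring_archimedean (A : lringType) : Prop :=
  forall a b : A, (forall n : nat, a *+ n ⊑ b) -> a ⊑ 0.

HB.mixin Record LOrderAlgebra_isBal (R : realType) A of LOrderAlgebra R A := {
  bal_bounded : lring_bounded A;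
  bal_archimedean : lring_archimedean A
}.

#[short(type="balType")]
HB.structure Definition Bal (R : realType) :=
  {A of LOrderAlgebra R A & LOrderAlgebra_isBal R A}.

Record balHom (R : realType) (A B : balType R) := BalHom {
  bal_fun :> A -> B;
  bal_additive : {morph bal_fun : a b / a + b};
  bal_scalable : forall r a, bal_fun (r •: a) = r •: bal_fun a;
  bal_unital : bal_fun 1 = 1;
  bal_multiplicative : {morph bal_fun : a b / a * b};
  bal_meet : {morph bal_fun : a b / a ⊓ b};
  bal_join : {morph bal_fun : a b / a ⊔ b}
}.

HB.mixin Record Nmodule_LatOrdered_isLMonoid S
    of GRing.Nmodule S & LatOrdered S := {
  lmonoid_leD2r : forall a b c : S, a ⊑ b <-> a + c ⊑ b + c;
  lmonoid_joinDr : forall a b c : S, (a ⊔ b) + c = (a + c) ⊔ (b + c);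
  lmonoid_meetDr : forall a b c : S, (a ⊓ b) + c = (a + c) ⊓ (b + c)
}.

#[short(type="lmonoidType")]
HB.structure Definition LMonoid :=
  {S of GRing.Nmodule S & LatOrdered S &
        Nmodule_LatOrdered_isLMonoid S}.

Record lmonoid_morphism (S T : lmonoidType) (f : S -> T) : Prop := {
  lmonoid_morphD : {morph f : a b / a + b};
  lmonoid_morph_meet : {morph f : a b / a ⊓ b};
  lmonoid_morph_join : {morph f : a b / a ⊔ b}
}.

(* S^+ *)
Definition nneg (S : lmonoidType) : Type := {a : S | 0 ⊑ a}.
Definition NNeg (S : lmonoidType) (a : S) (a0 : 0 ⊑ a) : nneg S := exist _ a a0.

Section LMonoidTheory.
Variable S : lmonoidType.
Implicit Types a b c : S.

Lemma lmonoid_addIr c a b : a + c = b + c -> a = b.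
Proof.
move=> e; apply/latle_anti.
by apply/andP; split; apply/(lmonoid_leD2r _ _ c); rewrite e latlexx.
Qed.

Lemma lmonoid_addr_ge0 a b : 0 ⊑ a -> 0 ⊑ b -> 0 ⊑ a + b.
Proof.
move=> a0 b0; apply: (latle_trans _ _ _ b0).
by move: a0 => /(lmonoid_leD2r _ _ b); rewrite add0r.
Qed.

Definition nneg_add (a b : nneg S) : nneg S :=
  @NNeg S (val a + val b) (lmonoid_addr_ge0 (valP a) (valP b)).

End LMonoidTheory.

Section LMonoidMorphism.
Variables (S T : lmonoidType) (f : S -> T).
Hypothesis fm : lmonoid_morphism f.

Lemma lmonoid_morph0 : f 0 = 0.
Proof.
by apply: (@lmonoid_addIr T (f 0)); rewrite -(lmonoid_morphD fm) !add0r.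
Qed.

Lemma lmonoid_morph_ge0 (a : S) : 0 ⊑ a -> 0 ⊑ f a.
Proof.
move=> a0; rewrite -lmonoid_morph0 -(latle_meet_l a0) (lmonoid_morph_meet fm).
exact: latmeet_le_r.
Qed.

Definition nneg_map (a : nneg S) : nneg T :=
  @NNeg T (f (val a)) (lmonoid_morph_ge0 (valP a)).

End LMonoidMorphism.

Section RealLMonoid.
Variable R : realType.
Implicit Types a b c : R.

Let real_leD2r a b c : a ⊑ b <-> a + c ⊑ b + c.
Proof. by rewrite /latle/= lerD2r. Qed.

Let real_joinDr a b c : (a ⊔ b) + c = (a + c) ⊔ (b + c).
Proof. by rewrite /latjoin/= !joinEtotal addr_maxl. Qed.

Let real_meetDr a b c : (a ⊓ b) + c = (a + c) ⊓ (b + c).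
Proof. by rewrite /latmeet/= !meetEtotal addr_minl. Qed.

#[non_forgetful_inheritance]
HB.instance Definition _ :=
  Nmodule_LatOrdered_isLMonoid.Build (Real.sort R)
    real_leD2r real_joinDr real_meetDr.

Definition nneg_real_mul (r s : nneg R) : nneg R :=
  @NNeg R (val r * val s) (mulr_ge0 (valP r) (valP s)).

End RealLMonoid.

HB.mixin Record LMonoid_isLSemialgebra (R : realType) S of LMonoid S := {
  nneg_mul : nneg S -> nneg S -> nneg S;
  nneg_one : nneg S;
  nneg_mulC : commutative nneg_mul;
  nneg_mulA : associative nneg_mul;
  nneg_mul1 : left_id nneg_one nneg_mul;
  nneg_mulDr : forall a b c,
    nneg_mul a (nneg_add b c) = nneg_add (nneg_mul a b) (nneg_mul a c);
  nneg_le_mul : forall a b c : nneg S,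
    val a ⊑ val b -> val (nneg_mul a c) ⊑ val (nneg_mul b c);
  rho : R -> S;
  rho_lmonoid : lmonoid_morphism rho;
  rho1 : rho 1 = val nneg_one;
  rhoM : forall r s : nneg R,
    nneg_map rho_lmonoid (nneg_real_mul r s) =
    nneg_mul (nneg_map rho_lmonoid r) (nneg_map rho_lmonoid s)
}.

#[short(type="lsemialgebraType")]
HB.structure Definition LSemialgebra (R : realType) :=
  {S of LMonoid S & LMonoid_isLSemialgebra R S}.

Definition lsemialgebra_bounded (R : realType) (S : lsemialgebraType R) : Prop :=
  forall a : S, exists r : R, [/\ 0 <= r, rho (- r) ⊑ a & a ⊑ rho r].

Definition lmonoid_archimedean (S : lmonoidType) : Prop :=
  forall a b c d : S, (forall n : nat, a *+ n + b ⊑ c *+ n + d) -> a ⊑ c.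

HB.mixin Record LSemialgebra_isSBal (R : realType) S of LSemialgebra R S := {
  sbal_bounded : lsemialgebra_bounded S;
  sbal_archimedean : lmonoid_archimedean S
}.

#[short(type="sbalType")]
HB.structure Definition SBal (R : realType) :=
  {S of LSemialgebra R S & LSemialgebra_isSBal R S}.

Section Action.
Variables (R : realType) (S : sbalType R).

Definition nneg_act (r : nneg R) (a : nneg S) : nneg S :=
  nneg_mul (nneg_map rho_lmonoid r) a.

Lemma sbal_shift (a : S) : exists s : nneg R, 0 ⊑ a + rho (val s).
Proof.
have [r [r0 ra _]] := sbal_bounded a.
exists (@NNeg R r r0) => /=.
move: ra => /(lmonoid_leD2r _ _ (rho r)).
by rewrite -(lmonoid_morphD rho_lmonoid) addNr (lmonoid_morph0 rho_lmonoid).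
Qed.

(* r (a + s) - r s *)
Definition act_shift (r : nneg R) (a : S) (s : nneg R)
    (as0 : 0 ⊑ a + rho (val s)) : S :=
  val (nneg_act r (NNeg as0)) + rho (- (val r * val s)).

(* By [actE], [act r a] does not depend on the shift that is chosen, and by
   [act_nneg] it agrees with [nneg_act] on S^+. *)
Definition act (r : nneg R) (a : S) : S :=
  act_shift r (projT2 (cid (sbal_shift a))).

Lemma act_shift_indep (r : nneg R) (a : S) (s t : nneg R)
    (as0 : 0 ⊑ a + rho (val s)) (at0 : 0 ⊑ a + rho (val t)) :
  act_shift r as0 = act_shift r at0.
Proof.
pose ps := nneg_map (@rho_lmonoid R S) s.
pose pt := nneg_map (@rho_lmonoid R S) t.
have E : nneg_add (nneg_act r (NNeg as0)) (nneg_act r pt) =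
         nneg_add (nneg_act r (NNeg at0)) (nneg_act r ps).
  rewrite /nneg_act -!nneg_mulDr; congr nneg_mul.
  by apply/val_inj; rewrite /= -!addrA [rho (val t) + _]addrC.
move/(congr1 val): E; rewrite /nneg_act -!rhoM /= => E.
pose k := rho (val r * val s + val r * val t) : S.
apply: (@lmonoid_addIr _ k); rewrite /act_shift /k /nneg_act -!addrA.
rewrite -!(lmonoid_morphD rho_lmonoid) addKr [X in rho (_ + X)]addrC addKr.
exact: E.
Qed.

Lemma actE (r : nneg R) (a : S) (s : nneg R) (as0 : 0 ⊑ a + rho (val s)) :
  act r a = act_shift r as0.
Proof. exact: act_shift_indep. Qed.

Lemma act_nneg (r : nneg R) (a : nneg S) : act r (val a) = val (nneg_act r a).
Proof.
pose z : nneg R := @NNeg R 0 (latlexx 0).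
have az : val a + rho (val z) = val a :> S.
  by rewrite (lmonoid_morph0 rho_lmonoid) addr0.
have az0 : 0 ⊑ (val a + rho (val z) : S) by rewrite az (valP a).
have E : NNeg az0 = a by apply/val_inj; rewrite -[RHS]az.
rewrite (actE r az0) /act_shift E mulr0 oppr0.
by rewrite [X in _ + X](lmonoid_morph0 rho_lmonoid) addr0.
Qed.

End Action.

Record sbalHom (R : realType) (S T : sbalType R) := SBalHom {
  sbal_fun :> S -> T;
  sbal_lmonoid : lmonoid_morphism sbal_fun;
  sbal_unital : sbal_fun (val (nneg_one : nneg S)) = val (nneg_one : nneg T);
  sbal_mul : forall a b : nneg S,
    nneg_map sbal_lmonoid (nneg_mul a b) =
    nneg_mul (nneg_map sbal_lmonoid a) (nneg_map sbal_lmonoid b);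
  sbal_act : forall (r : nneg R) (a : S), sbal_fun (act r a) = act r (sbal_fun a)
}.

Section BalIsSBal.
Variables (R : realType) (A : balType R).
Implicit Types a b c : A.

Let bal_leD2r a b c : a ⊑ b <-> a + c ⊑ b + c.
Proof.
split; first exact: lring_lerD2r.
by move=> /(lring_lerD2r _ _ (- c)); rewrite !addrK.
Qed.

Let bal_joinDr a b c : (a ⊔ b) + c = (a + c) ⊔ (b + c).
Proof.
apply/latle_anti; rewrite latleUx; apply/and3P; split.
- apply/(bal_leD2r _ _ (- c)); rewrite addrK latleUx.
  by apply/andP; split; apply/(bal_leD2r _ _ c); rewrite subrK ?latle_join_l ?latle_join_r.
- by apply: lring_lerD2r; rewrite latle_join_l.
- by apply: lring_lerD2r; rewrite latle_join_r.
Qed.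

Let bal_meetDr a b c : (a ⊓ b) + c = (a + c) ⊓ (b + c).
Proof.
apply/latle_anti/andP; split.
- by rewrite latlexI; apply/andP; split; apply: lring_lerD2r; rewrite ?latmeet_le_l ?latmeet_le_r.
- apply/(bal_leD2r _ _ (- c)); rewrite addrK latlexI.
  by apply/andP; split; apply/(bal_leD2r _ _ c); rewrite subrK ?latmeet_le_l ?latmeet_le_r.
Qed.

#[non_forgetful_inheritance]
HB.instance Definition _ :=
  Nmodule_LatOrdered_isLMonoid.Build (Bal.sort A) bal_leD2r bal_joinDr bal_meetDr.

Let bal_ler01 : 0 ⊑ (1 : A).
Proof.
have [n [_ h]] := bal_bounded (- 1 : A).
have : 0 ⊑ (n.+1%:R : A).
  by move: h => /(bal_leD2r _ _ 1); rewrite addNr -natr1.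
move=> /(@rscale_ge0 R A n.+1%:R^-1); rewrite invr_ge0 ler0n => /(_ isT).
have -> : n.+1%:R = n.+1%:R •: 1 :> A by rewrite rscale_nat.
by rewrite rscaleA mulVf ?pnatr_eq0// rscale1.
Qed.

Definition bal_mul (a b : nneg A) : nneg A :=
  @NNeg A (val a * val b) (lring_mulr_ge0 _ _ (valP a) (valP b)).
Definition bal_one : nneg A := @NNeg A 1 bal_ler01.
Definition bal_rho (r : R) : A := r •: 1.

Let bal_mulC : commutative bal_mul.
Proof. by move=> a b; apply/val_inj; rewrite /= mulrC. Qed.
Let bal_mulA : associative bal_mul.
Proof. by move=> a b c; apply/val_inj; rewrite /= mulrA. Qed.
Let bal_mul1 : left_id bal_one bal_mul.
Proof. by move=> a; apply/val_inj; rewrite /= mul1r. Qed.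
Let bal_mulDr (a b c : nneg A) :
  bal_mul a (nneg_add b c) = nneg_add (bal_mul a b) (bal_mul a c).
Proof. by apply/val_inj; rewrite /= mulrDr. Qed.
Let bal_subr_ge0 a b : a ⊑ b <-> 0 ⊑ b - a.
Proof. by rewrite (bal_leD2r a b (- a)) subrr. Qed.
Let bal_le_mul (a b c : nneg A) :
  val a ⊑ val b -> val (bal_mul a c) ⊑ val (bal_mul b c).
Proof.
move=> /bal_subr_ge0 ab; apply/bal_subr_ge0; rewrite /= -mulrBl.
exact: lring_mulr_ge0 _ _ ab (valP c).
Qed.

Let bal_rho_homo (r s : R) : r ⊑ s -> bal_rho r ⊑ bal_rho s.
Proof.
move=> rs; apply/bal_subr_ge0; rewrite /bal_rho -rscaleN -rscaleDl.
by apply: rscale_ge0; rewrite ?subr_ge0.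
Qed.

Lemma bal_rho_lmonoid : lmonoid_morphism bal_rho.
Proof.
split=> r s.
- by rewrite /bal_rho rscaleDl.
- have [rs|/ltW rs] := leP r s.
    by rewrite !latle_meet_l//; apply: bal_rho_homo.
  by rewrite latmeetC [RHS]latmeetC !latle_meet_l//; apply: bal_rho_homo.
- have [rs|/ltW rs] := leP r s.
    by rewrite !latle_join_eq//; apply: bal_rho_homo.
  by rewrite latjoinC [RHS]latjoinC !latle_join_eq//; apply: bal_rho_homo.
Qed.

Let bal_rho1 : bal_rho 1 = val bal_one.
Proof. exact: rscale1. Qed.

Let bal_rhoM (r s : nneg R) :
  nneg_map bal_rho_lmonoid (nneg_real_mul r s) =
  bal_mul (nneg_map bal_rho_lmonoid r) (nneg_map bal_rho_lmonoid s).
Proof.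
by apply/val_inj; rewrite /= /bal_rho -rscaleAl mul1r rscaleA.
Qed.

#[non_forgetful_inheritance]
HB.instance Definition _ :=
  LMonoid_isLSemialgebra.Build R (Bal.sort A)
    bal_mulC bal_mulA bal_mul1 bal_mulDr bal_le_mul bal_rho1 bal_rhoM.

Let bal_sbal_bounded : lsemialgebra_bounded (A : lsemialgebraType R).
Proof.
move=> a; have [n [h1 h2]] := bal_bounded a.
exists n%:R; split; first exact: ler0n.
  by rewrite /rho/= /bal_rho rscaleN rscale_nat.
by rewrite /rho/= /bal_rho rscale_nat.
Qed.

Let bal_sbal_archimedean : lmonoid_archimedean A.
Proof.
move=> a b c d h; have: a - c ⊑ 0.
  apply: (@bal_archimedean R A _ (d - b)) => n.
  apply/(bal_leD2r _ _ (b + c *+ n)).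
  have := h n; rewrite mulrnBl [a *+ n + b]addrC.
  have -> : a *+ n - c *+ n + (b + c *+ n) = b + a *+ n.
    by rewrite [b + _]addrC addrA subrK addrC.
  by have -> : d - b + (b + c *+ n) = c *+ n + d by rewrite addrA subrK addrC.
by move=> /(bal_leD2r _ _ c); rewrite subrK add0r.
Qed.

#[non_forgetful_inheritance]
HB.instance Definition _ :=
  LSemialgebra_isSBal.Build R (Bal.sort A) bal_sbal_bounded bal_sbal_archimedean.

Definition bal_sbal : sbalType R := A.

Lemma bal_sbal_rhoE (r : R) : rho r = r •: 1 :> bal_sbal.
Proof. by []. Qed.

Lemma bal_actE (r : nneg R) (a : A) : act r (a : bal_sbal) = val r •: a.
Proof.
have [s s0] := sbal_shift (a : bal_sbal).
rewrite (actE r s0) /act_shift /= !bal_sbal_rhoE.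
rewrite -rscaleAl mul1r rscaleN rscaleDr rscaleA.
exact: addrK.
Qed.

End BalIsSBal.

Record category := Category {
  obj :> Type;
  mor : obj -> obj -> Type;
  idm : forall X, mor X X;
  compm : forall X Y Z, mor Y Z -> mor X Y -> mor X Z;
  comp1m : forall X Y (f : mor X Y), compm (idm Y) f = f;
  compm1 : forall X Y (f : mor X Y), compm f (idm X) = f;
  compmA : forall W X Y Z (h : mor Y Z) (g : mor X Y) (f : mor W X),
    compm h (compm g f) = compm (compm h g) f
}.

Notation "g ∘c f" := (compm g f) (at level 40, left associativity).

Record functor (C D : category) := Functor {
  fobj :> C -> D;
  fmap : forall X Y : C, mor X Y -> mor (fobj X) (fobj Y);
  fmap1 : forall X : C, fmap (idm X) = idm (fobj X);
  fmapM : forall (X Y Z : C) (g : mor Y Z) (f : mor X Y),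
    fmap (g ∘c f) = fmap g ∘c fmap f
}.

(* L is left adjoint to U *)
Record adjunction (C D : category) (L : functor C D) (U : functor D C) :=
  Adjunction {
  transpose : forall (X : C) (Y : D), mor (L X) Y -> mor X (U Y);
  transpose_bij : forall X Y, bijective (@transpose X Y);
  transpose_natl : forall (X' X : C) (Y : D) (g : mor (L X) Y) (h : mor X' X),
    transpose (g ∘c fmap L h) = transpose g ∘c h;
  transpose_natr : forall (X : C) (Y Y' : D) (k : mor Y Y') (g : mor (L X) Y),
    transpose (k ∘c g) = fmap U k ∘c transpose g
}.

(* An inclusion functor, up to renaming of objects and morphisms. *)
Definition embedding (C D : category) (F : functor C D) : Prop :=
  injective (fobj F) /\ forall X Y : C, injective (@fmap C D F X Y).

Definition full (C D : category) (F : functor C D) : Prop :=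
  forall (X Y : C) (g : mor (F X) (F Y)), exists f : mor X Y, fmap F f = g.

Definition reflective (C D : category) (F : functor C D) : Prop :=
  exists L : functor D C, inhabited (adjunction L F).

Definition full_reflective_subcategory (C D : category) (F : functor C D) : Prop :=
  [/\ embedding F, full F & reflective F].

Section BalCat.
Variable R : realType.

Lemma balHom_eq (A B : balType R) (f g : balHom A B) : f =1 g -> f = g.
Proof.
case: f g => [f fD fZ f1 fM fI fU] [g gD gZ g1 gM gI gU] /= /funext e.
by subst g; congr BalHom; apply: Prop_irrelevance.
Qed.

Definition bal_id (A : balType R) : balHom A A :=
  @BalHom R A A id (fun _ _ => erefl) (fun _ _ => erefl) erefl
    (fun _ _ => erefl) (fun _ _ => erefl) (fun _ _ => erefl).

Definition bal_comp (A B C : balType R) (g : balHom B C) (f : balHom A B) :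
  balHom A C.
Proof.
apply: (@BalHom R A C (g \o f)) => [a b|r a||a b|a b|a b] /=.
- by rewrite !bal_additive.
- by rewrite !bal_scalable.
- by rewrite !bal_unital.
- by rewrite !bal_multiplicative.
- by rewrite !bal_meet.
- by rewrite !bal_join.
Defined.

Definition bal : category.
Proof.
by apply: (@Category (balType R) (@balHom R) bal_id bal_comp) => *;
  apply: balHom_eq.
Defined.

Lemma sbalHom_eq (S T : sbalType R) (f g : sbalHom S T) : f =1 g -> f = g.
Proof.
case: f g => [f fl f1 fM fa] [g gl g1 gM ga] /= /funext e.
subst g; have e : fl = gl by apply: Prop_irrelevance.
by subst gl; congr SBalHom; apply: Prop_irrelevance.
Qed.

Lemma lmonoid_morphism_id (S : lmonoidType) : lmonoid_morphism (@id S).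
Proof. by []. Qed.

Lemma lmonoid_morphism_comp (S T U : lmonoidType) (g : T -> U) (f : S -> T) :
  lmonoid_morphism g -> lmonoid_morphism f -> lmonoid_morphism (g \o f).
Proof.
by move=> [gD gI gU] [fD fI fU]; split=> a b /=; rewrite ?fD ?fI ?fU ?gD ?gI ?gU.
Qed.

Lemma nneg_map_id (S : lmonoidType) (a : nneg S) :
  nneg_map (lmonoid_morphism_id S) a = a.
Proof. exact/val_inj. Qed.

Lemma nneg_map_comp (S T U : lmonoidType) (g : T -> U) (f : S -> T)
    (gl : lmonoid_morphism g) (fl : lmonoid_morphism f) (a : nneg S) :
  nneg_map (lmonoid_morphism_comp gl fl) a = nneg_map gl (nneg_map fl a).
Proof. exact/val_inj. Qed.

Definition sbal_id (S : sbalType R) : sbalHom S S.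
Proof.
by apply: (@SBalHom R S S id (lmonoid_morphism_id S)) => // a b;
  rewrite !nneg_map_id.
Defined.

Definition sbal_comp (S T U : sbalType R) (g : sbalHom T U) (f : sbalHom S T) :
  sbalHom S U.
Proof.
apply: (@SBalHom R S U (g \o f)
  (lmonoid_morphism_comp (sbal_lmonoid g) (sbal_lmonoid f))) => /= [|a b|r a].
- by rewrite !sbal_unital.
- by rewrite !nneg_map_comp !sbal_mul.
- by rewrite !sbal_act.
Defined.

Definition sbal : category.
Proof.
by apply: (@Category (sbalType R) (@sbalHom R) sbal_id sbal_comp) => *;
  apply: sbalHom_eq.
Defined.

Lemma bal_hom_lmonoid (A B : balType R) (f : balHom A B) :
  @lmonoid_morphism (bal_sbal A) (bal_sbal B) f.
Proof. by split; [apply: bal_additive|apply: bal_meet|apply: bal_join]. Qed.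

Definition bal_sbal_hom (A B : balType R) (f : balHom A B) :
  sbalHom (bal_sbal A) (bal_sbal B).
Proof.
apply: (@SBalHom R (bal_sbal A) (bal_sbal B) f (bal_hom_lmonoid f)) =>
  [|a b|r a].
- exact: bal_unital.
- by apply/val_inj; apply: bal_multiplicative.
- by rewrite !bal_actE; apply: bal_scalable.
Defined.

Definition bal_to_sbal : functor bal sbal.
Proof.
by apply: (@Functor bal sbal (@bal_sbal R) bal_sbal_hom) => *;
  apply: sbalHom_eq.
Defined.

End BalCat.

(* Main.v *)
(** The inclusion is full because a morphism between objects of bal is
    R-linear by the action and multiplicative after shifting by constants, and
    it is injective on objects because product, scalar multiplication and
    opposite are determined by the sbal structure.

    The group completion of S is not the reflection: the multiplication of S^+
    extends to it, but positive elements may have a product that is not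
    positive.  For instance S = {(x, y) : x <= y}, where the multiplication of
    S^+ = {p + qe : p, q >= 0} with e = (0, 1) is determined by e^2 = 0, is in
    sbal, and (1 - e)^2 = 1 - 2e = (1, -1).  The reflection is instead
    the image of the group completion in the product of all sbal-morphisms from
    S to objects of bal: formal differences of elements of S^+ are identified,
    and ordered, according to their values under all these morphisms, so that
    every axiom of bal is inherited from the targets. *)

Require Import Defs.
From HB Require Import structures.
From mathcomp Require Import all_boot all_order all_algebra generic_quotient.
From mathcomp Require Import boolp reals.

Set Implicit Arguments.
Unset Strict Implicit.
Unset Printing Implicit Defensive.

Import Order.TTheory GRing.Theory Num.Theory.
Local Open Scope ring_scope.
Local Open Scope quotient_scope.

(** By proof irrelevance the equality of the first components is [erefl], so the transport along it
    is trivial. *)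
Lemma existT_inj (I : Type) (F : I -> Type) (i : I) (x y : F i) :
  existT F i x = existT F i y -> x = y.
Proof.
move=> e; rewrite -[y]/(projT2 (existT F i y)) -(projT2_eq e).
by rewrite (Prop_irrelevance (projT1_eq e) erefl).
Qed.

(** * Real numbers as differences of nonnegative ones *)

Definition nneg_norm (R : realType) (r : R) : nneg R :=
  @NNeg R `|r| (normr_ge0 r).

Lemma real_neg_part_ge0 (R : realType) (r : R) : 0 <= `|r| - r.
Proof. by rewrite subr_ge0 ler_norm. Qed.

(** Twice the usual negative part: [r] is [nneg_norm r] minus this number, and both lie where the
    action is defined. *)
Definition nneg_neg_part (R : realType) (r : R) : nneg R :=
  @NNeg R (`|r| - r) (real_neg_part_ge0 r).

(** * The operations of bal expressed in the sbal structure *)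

Section BalTheory.
Variables (R : realType) (A : balType R).
Implicit Types (a b c : A) (r s : R).

Lemma rscalerE r a : r •: a = (r •: 1) * a.
Proof. by rewrite -rscaleAl mul1r. Qed.

(** Characterizes multiplication by a real of any sign through addition and nonnegative scalars,
    which morphisms of sbal respect. *)
Lemma rscale_normP r a c :
  c + val (nneg_neg_part r) •: a = val (nneg_norm r) •: a <-> c = r •: a.
Proof.
have -> : val (nneg_norm r) •: a = r •: a + val (nneg_neg_part r) •: a.
  by rewrite -rscaleDl /= addrC subrK.
by split=> [/addIr|->].
Qed.

Lemma mul_shift a b s t :
  (a + s •: 1) * (b + t •: 1) = a * b + t •: a + s •: b + (s * t) •: 1.
Proof.
rewrite mulrDl !mulrDr -!rscalerE !addrA; congr (_ + _ + _ + _).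
  by rewrite mulrC -rscalerE.
by rewrite rscaleA.
Qed.

End BalTheory.

Section SBalRelations.
Variables (R : realType) (S : sbalType R).
Implicit Types a b c : S.

(* The graphs of the operations of an algebra that S does not have itself.
   Products are shifted: (a + s) (b + t) = c + t a + s b + s t. *)
Definition is_product a b c : Prop :=
  exists (s t : nneg R) (as0 : 0 ⊑ a + rho (val s)) (bt0 : 0 ⊑ b + rho (val t)),
    val (nneg_mul (NNeg as0) (NNeg bt0)) =
    c + act t a + act s b + rho (val s * val t).

Definition is_multiple (r : R) a c : Prop :=
  c + act (nneg_neg_part r) a = act (nneg_norm r) a.

Definition is_opposite a c : Prop := c + a = 0.

End SBalRelations.

Section BalRelations.
Variables (R : realType) (A : balType R).
Implicit Types a b c : bal_sbal A.

(** Expanding the shifted product by [mul_shift] leaves the same correction terms on both sides, and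
    they cancel whatever the shifts are. *)
Lemma is_productE a b c : is_product a b c = (c = (a : A) * (b : A)).
Proof.
have expand (s t : nneg R) :
  ((a : A) + rho (val s)) * ((b : A) + rho (val t)) =
  (a : A) * (b : A) + act t a + act s b + rho (val s * val t).
  by rewrite !bal_actE; exact: mul_shift.
apply/propext; split.
  move=> [s [t [as0 [bt0 e]]]]; move: e; rewrite [LHS]expand -!addrA.
  by move=> /lmonoid_addIr ->.
move=> ->; have [s as0] := sbal_shift a; have [t bt0] := sbal_shift b.
by exists s, t, as0, bt0; exact: expand.
Qed.

Lemma is_multipleE r a c : is_multiple r a c = (c = r •: (a : A)).
Proof. by apply/propext; rewrite /is_multiple !bal_actE; exact: rscale_normP. Qed.

Lemma is_oppositeE a c : is_opposite a c = (c = - (a : A)).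
Proof.
apply/propext; rewrite /is_opposite; split=> [|->]; last exact: addNr.
by move=> e; rewrite -[LHS](@addrK A a) [X in X - _]e [LHS]add0r.
Qed.

End BalRelations.

(** * The inclusion is an embedding *)

(** The data of an object of bal. Opposite, product and scalar multiplication appear as relations,
    because only their graphs can be read off from an object of sbal. The choice and equality mixins
    are listed because equal objects must agree in them too. *)
Definition ops (R : realType) (T : Type) : Type :=
  hasChoice.axioms_ T * Equality.mixin_of T * T * T *
    (T -> T -> T) * (T -> T -> T) * (T -> T -> T) * (T -> T -> bool) *
    (T -> T -> Prop) * (T -> T -> T -> Prop) * (R -> T -> T -> Prop).

Definition sbal_ops (R : realType) (S : sbalType R) : {T : Type & ops R T} :=
  existT (ops R) S
  (SBal.choice_hasChoice_mixin (SBal.class S),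
   SBal.eqtype_hasDecEq_mixin (SBal.class S),
   0 : S, val (nneg_one : nneg S),
   @GRing.add S, @latmeet S, @latjoin S, @latle S,
   @is_opposite _ S, @is_product _ S, @is_multiple _ S).

Definition bal_ops (R : realType) (A : balType R) : {T : Type & ops R T} :=
  existT (ops R) A
  (Bal.choice_hasChoice_mixin (Bal.class A),
   Bal.eqtype_hasDecEq_mixin (Bal.class A),
   0 : A, 1 : A,
   @GRing.add A, @latmeet A, @latjoin A, @latle A,
   (fun a b => b = - a), (fun a b c => c = a * b), (fun r a b => b = r •: a)).

Lemma sbal_opsE (R : realType) (A : balType R) :
  sbal_ops (bal_sbal A) = bal_ops A.
Proof.
rewrite /sbal_ops; congr existT; congr (_, _, _, _).
- by apply/funext => a; apply/funext => c; rewrite is_oppositeE.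
- by do 3![apply/funext => ?]; rewrite is_productE.
- by do 3![apply/funext => ?]; rewrite is_multipleE.
Qed.

(** Apart from [ops], an object of bal consists of proofs, and a function is determined by its
    graph. *)
Lemma bal_ops_inj (R : realType) : injective (@bal_ops R).
Proof.
move=> A B; rewrite /bal_ops.
have ops_inj T (u v : ops R T) : existT _ T u = existT _ T v -> u = v.
  exact: existT_inj.
case: A => T [[op] [z] [ad] zm [am] [ab] ch eq [ag] sr [cm] lo lr al bl].
case: B => T' [[op'] [z'] [ad'] zm' [am'] [ab'] ch' eq' [ag'] sr' [cm'] lo' lr' al' bl'].
case: lo lr al bl => le meet join p1 p2 p3 p4 p5 lr al bl.
case: lo' lr' al' bl' => le' meet' join' p1' p2' p3' p4' p5' lr' al' bl'.
case: sr cm lr al bl => one mul q1 q2 q3 q4 q5 q6 q7 cm lr al bl.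
case: sr' cm' lr' al' bl' => one' mul' q1' q2' q3' q4' q5' q6' q7' cm' lr' al' bl'.
case: al bl => sc r1 r2 r3 r4 r5 r6 bl.
case: al' bl' => sc' r1' r2' r3' r4' r5' r6' bl'.
rewrite /=.
move=> e.
have e1 : T = T' by exact: (projT1_eq e).
subst T'.
have := ops_inj _ _ _ e; clear e.
case=> ech eeq ez eone ead emeet ejoin ele eop emul esc.
have {}eop : op = op'.
  apply/funext => a.
  (* The two graphs are compared at the value of the first function, where one side holds by
     reflexivity. *)
  have h : (op a = op a) = (op a = op' a) := congr1 (fun r => r a (op a)) eop.
  by rewrite -h.
have {}emul : mul = mul'.
  apply/funext => a; apply/funext => b.
  have h : (mul a b = mul a b) = (mul a b = mul' a b) :=
    congr1 (fun r => r a b (mul a b)) emul.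
  by rewrite -h.
have {}esc : sc = sc'.
  apply/funext => r; apply/funext => a.
  have h : (sc r a = sc r a) = (sc r a = sc' r a) :=
    congr1 (fun f => f r a (sc r a)) esc.
  by rewrite -h.
(* The equations still mention the packed structures; conversion turns them into equations between
   variables, to which [subst] applies. *)
have {}ez : z = z' := ez; have {}eone : one = one' := eone.
have {}ead : ad = ad' := ead; have {}emeet : meet = meet' := emeet.
have {}ejoin : join = join' := ejoin; have {}ele : le = le' := ele.
subst ch' eq' z' one' ad' meet' join' le' op' mul' sc'.
(* These mixins have only proofs as fields; once opened, they are identified by proof
   irrelevance. *)
case: zm lr bl => z1 [l1 l2] [b1 b2]; case: zm' lr' bl' => z1' [l1' l2'] [b1' b2'].
repeat match goal with p : ?P, q : ?P |- _ =>
  match type of P with Prop => have ? := Prop_irrelevance p q; subst q end end.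
by [].
Qed.

Lemma bal_sbal_inj (R : realType) : injective (@bal_sbal R).
Proof.
move=> A B e; apply: bal_ops_inj.
by rewrite -!sbal_opsE e.
Qed.

Lemma bal_to_sbal_embedding (R : realType) : embedding (bal_to_sbal R).
Proof.
split=> [|A B f g e]; first exact: bal_sbal_inj.
by apply: balHom_eq => a; rewrite -[f a]/(bal_sbal_hom f a) [bal_sbal_hom f]e.
Qed.

(** * The inclusion is full *)

Section Full.
Variables (R : realType) (A B : balType R).
Variable f : sbalHom (bal_sbal A) (bal_sbal B).
Implicit Types a b : A.

Let phi (a : A) : B := f a.

Let phiD a b : phi (a + b) = phi a + phi b.
Proof. exact: (lmonoid_morphD (sbal_lmonoid f)). Qed.

Let phi1 : phi 1 = 1. Proof. exact: (sbal_unital f). Qed.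

Let phiZ_ge0 (r : nneg R) a : phi (val r •: a) = val r •: phi a.
Proof. by have := sbal_act f r a; rewrite !bal_actE. Qed.

Let phiZ r a : phi (r •: a) = r •: phi a.
Proof. by apply/rscale_normP; rewrite -!phiZ_ge0 -phiD (rscale_normP _ _ _).2. Qed.

Let phiM_ge0 (a b : A) : 0 ⊑ a -> 0 ⊑ b -> phi (a * b) = phi a * phi b.
Proof.
move=> a0 b0.
have := sbal_mul f (@NNeg (bal_sbal A) a a0) (@NNeg (bal_sbal A) b b0).
by move/(congr1 val).
Qed.

Let phiM a b : phi (a * b) = phi a * phi b.
Proof.
have [s as0] := sbal_shift (a : bal_sbal A).
have [t bt0] := sbal_shift (b : bal_sbal A).
(* The shifted factors are positive, so their product is preserved; by linearity the correction
   terms of [mul_shift] agree and cancel. *)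
have := phiM_ge0 as0 bt0.
rewrite !bal_sbal_rhoE !phiD !phiZ phi1 !mul_shift !phiD !phiZ phi1.
by rewrite -!addrA => /addIr.
Qed.

Lemma bal_sbal_full : exists g : balHom A B, bal_sbal_hom g = f.
Proof.
have phiI : {morph phi : a b / a ⊓ b} := lmonoid_morph_meet (sbal_lmonoid f).
have phiU : {morph phi : a b / a ⊔ b} := lmonoid_morph_join (sbal_lmonoid f).
exists (BalHom phiD phiZ phi1 phiM phiI phiU).
exact: sbalHom_eq.
Qed.

End Full.

(** * The reflection as a quotient of formal differences *)

Section Reflection.
Variables (R : realType) (S : sbalType R).

Definition formal_diff : Type := (nneg S * nneg S)%type.
HB.instance Definition _ := Choice.on formal_diff.

Definition ev (B : balType R) (f : sbalHom S (bal_sbal B)) (z : formal_diff) : B :=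
  (f (val z.1) : B) - (f (val z.2) : B).

(* Impredicativity of Prop: the morphisms range over all of bal, and no set of
   representatives of the targets is needed. *)
Definition diff_eq (z w : formal_diff) : bool :=
  `[< forall (B : balType R) (f : sbalHom S (bal_sbal B)), ev f z = ev f w >].

Lemma diff_eq_refl : reflexive diff_eq.
Proof. by move=> z; apply/asboolP. Qed.

Lemma diff_eq_sym : symmetric diff_eq.
Proof. by move=> z w; apply/asboolP/asboolP => h B f; rewrite h. Qed.

Lemma diff_eq_trans : transitive diff_eq.
Proof.
by move=> w z v /asboolP zw /asboolP wv; apply/asboolP => B f; rewrite zw.
Qed.

Canonical diff_equiv := EquivRel diff_eq diff_eq_refl diff_eq_sym diff_eq_trans.

Definition reflection := {eq_quot diff_equiv}.
HB.instance Definition _ := Choice.on reflection.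

Definition of_diff (z : formal_diff) : reflection := \pi_reflection z.

Definition evq (B : balType R) (f : sbalHom S (bal_sbal B)) (x : reflection) : B :=
  ev f (repr x).

Lemma evq_of_diff (B : balType R) (f : sbalHom S (bal_sbal B)) (z : formal_diff) :
  evq f (of_diff z) = ev f z.
Proof.
have /eqP : repr (\pi_reflection z) = z %[mod reflection] by rewrite reprK.
by rewrite eqmodE => /asboolP; apply.
Qed.

(** Morphisms to objects of bal separate points, so identities in the reflection can be checked in
    every target. *)
Lemma evq_inj (x y : reflection) :
  (forall (B : balType R) (f : sbalHom S (bal_sbal B)), evq f x = evq f y) ->
  x = y.
Proof.
move=> h; rewrite -[x]reprK -[y]reprK; apply/eqP; rewrite eqmodE.
by apply/asboolP.
Qed.

End Reflection.

(** * Morphisms from an object of sbal to one of bal *)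

Lemma lmonoid_morph_le (S T : lmonoidType) (f : S -> T) (a b : S) :
  lmonoid_morphism f -> a ⊑ b -> f a ⊑ f b.
Proof.
by move=> fm /latle_meet_l <-; rewrite (lmonoid_morph_meet fm); exact: latmeet_le_r.
Qed.

Section SBalToBal.
Variables (R : realType) (S : sbalType R) (B : balType R).
Variable f : sbalHom S (bal_sbal B).
Implicit Types a b : S.

Definition to_bal (a : S) : B := f a.

Lemma to_balD a b : to_bal (a + b) = to_bal a + to_bal b.
Proof. exact: (lmonoid_morphD (sbal_lmonoid f)). Qed.

Lemma to_balI a b : to_bal (a ⊓ b) = to_bal a ⊓ to_bal b.
Proof. exact: (lmonoid_morph_meet (sbal_lmonoid f)). Qed.

Lemma to_balU a b : to_bal (a ⊔ b) = to_bal a ⊔ to_bal b.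
Proof. exact: (lmonoid_morph_join (sbal_lmonoid f)). Qed.

Lemma to_bal0 : to_bal 0 = 0.
Proof. exact: (lmonoid_morph0 (sbal_lmonoid f)). Qed.

Lemma to_bal1 : to_bal (val (nneg_one : nneg S)) = 1.
Proof. exact: (sbal_unital f). Qed.

Lemma to_balM (a b : nneg S) :
  to_bal (val (nneg_mul a b)) = to_bal (val a) * to_bal (val b).
Proof. by have /(congr1 val) := sbal_mul f a b. Qed.

Lemma to_bal_act (r : nneg R) a : to_bal (act r a) = val r •: to_bal a.
Proof. by rewrite /to_bal sbal_act bal_actE. Qed.

Lemma to_bal_le a b : a ⊑ b -> to_bal a ⊑ to_bal b.
Proof. exact: lmonoid_morph_le (sbal_lmonoid f). Qed.

Lemma rho_act (r : nneg R) : rho (val r) = act r (val (nneg_one : nneg S)).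
Proof. by rewrite act_nneg /nneg_act nneg_mulC nneg_mul1. Qed.

(** For nonnegative reals this comes from the action on the unit ([rho_act]); [rscale_normP] extends
    it to all reals. *)
Lemma to_bal_rho (r : R) : to_bal (rho r) = r •: 1.
Proof.
apply/rscale_normP; rewrite -to_bal1 -!to_bal_act -!rho_act -to_balD.
by rewrite -(lmonoid_morphD rho_lmonoid) /= addrC subrK.
Qed.

(** The bound [n] depends on neither [f] nor [B]; this uniformity makes the reflection bounded. *)
Lemma to_bal_le_natr a (r : R) n :
  r <= n%:R -> a ⊑ rho r -> to_bal a ⊑ n%:R.
Proof.
move=> rn ar; rewrite -(rscale_nat n (1 : B)) -to_bal_rho; apply: to_bal_le.
exact: latle_trans ar (lmonoid_morph_le rho_lmonoid rn).
Qed.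

End SBalToBal.

(** * Order and differences in an object of bal *)

Section BalOrder.
Variables (R : realType) (A : balType R).
Implicit Types a b c d : A.

Lemma bal_subr_ge0 a b : 0 ⊑ b - a = (a ⊑ b).
Proof.
apply/idP/idP; first by move=> /(lring_lerD2r _ _ a); rewrite subrK add0r.
by move=> /(lring_lerD2r _ _ (- a)); rewrite subrr.
Qed.

Lemma bal_meetDr a b c : (a ⊓ b) + c = (a + c) ⊓ (b + c).
Proof. exact: (@lmonoid_meetDr (bal_sbal A)). Qed.

Lemma bal_joinDr a b c : (a ⊔ b) + c = (a + c) ⊔ (b + c).
Proof. exact: (@lmonoid_joinDr (bal_sbal A)). Qed.

(** Both differences are brought to the common subtrahend [b + d]. This is the formula behind
    [diff_meet], as [bal_joinB] is behind [diff_join]. *)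
Lemma bal_meetB a b c d : (a - b) ⊓ (c - d) = (a + d) ⊓ (c + b) - (b + d).
Proof.
by rewrite bal_meetDr !opprD addrACA subrr addr0 [- b - d]addrC addrACA subrr addr0.
Qed.

Lemma bal_joinB a b c d : (a - b) ⊔ (c - d) = ((a + d) ⊔ (c + b)) - (b + d).
Proof.
by rewrite bal_joinDr !opprD addrACA subrr addr0 [- b - d]addrC addrACA subrr addr0.
Qed.

Lemma bal_sub_le a b c : a ⊑ c -> 0 ⊑ b -> a - b ⊑ c.
Proof.
rewrite -[a - b ⊑ c]bal_subr_ge0 -(bal_subr_ge0 a c) opprB addrA.
rewrite addrAC; exact: (@lmonoid_addr_ge0 (bal_sbal A)).
Qed.

Lemma bal_le_sub a b c : 0 ⊑ a -> b ⊑ c -> - c ⊑ a - b.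
Proof.
rewrite -[- c ⊑ _]bal_subr_ge0 -(bal_subr_ge0 b c) opprK -addrA [- b + c]addrC.
exact: (@lmonoid_addr_ge0 (bal_sbal A)).
Qed.

End BalOrder.

(** * Operations on formal differences and their values *)

Section Operations.
Variables (R : realType) (S : sbalType R).
Implicit Types z w : formal_diff S.

Lemma nneg_meet_ge0 (a b : nneg S) : 0 ⊑ val a ⊓ val b.
Proof. by rewrite latlexI (valP a) (valP b). Qed.

Lemma nneg_join_ge0 (a b : nneg S) : 0 ⊑ val a ⊔ val b.
Proof. exact: latle_trans (valP a) (latle_join_l _ _). Qed.

Definition nneg_meet (a b : nneg S) : nneg S := NNeg (nneg_meet_ge0 a b).
Definition nneg_join (a b : nneg S) : nneg S := NNeg (nneg_join_ge0 a b).
Definition nneg0 : nneg S := NNeg (latlexx 0).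

Definition diff0 : formal_diff S := (nneg0, nneg0).
Definition diff1 : formal_diff S := (nneg_one, nneg0).
Definition diff_opp z : formal_diff S := (z.2, z.1).
Definition diff_add z w : formal_diff S := (nneg_add z.1 w.1, nneg_add z.2 w.2).
Definition diff_mul z w : formal_diff S :=
  (nneg_add (nneg_mul z.1 w.1) (nneg_mul z.2 w.2),
   nneg_add (nneg_mul z.1 w.2) (nneg_mul z.2 w.1)).
Definition diff_meet z w : formal_diff S :=
  (nneg_meet (nneg_add z.1 w.2) (nneg_add w.1 z.2), nneg_add z.2 w.2).
Definition diff_join z w : formal_diff S :=
  (nneg_join (nneg_add z.1 w.2) (nneg_add w.1 z.2), nneg_add z.2 w.2).
Definition diff_rho (r : R) : formal_diff S :=
  (nneg_map rho_lmonoid (nneg_norm r), nneg_map rho_lmonoid (nneg_neg_part r)).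

Section Eval.
Variables (B : balType R) (f : sbalHom S (bal_sbal B)).

Lemma evE z : ev f z = to_bal f (val z.1) - to_bal f (val z.2).
Proof. by []. Qed.

Lemma ev0 : ev f diff0 = 0.
Proof. by rewrite evE subrr. Qed.

Lemma ev1 : ev f diff1 = 1.
Proof. by rewrite evE to_bal0 to_bal1 subr0. Qed.

Lemma ev_opp z : ev f (diff_opp z) = - ev f z.
Proof. by rewrite !evE opprB. Qed.

Lemma ev_add z w : ev f (diff_add z w) = ev f z + ev f w.
Proof. by rewrite !evE !to_balD opprD addrACA. Qed.

Lemma ev_mul z w : ev f (diff_mul z w) = ev f z * ev f w.
Proof.
rewrite !evE !to_balD !to_balM mulrBl !mulrBr opprB opprD !addrA.
by congr (_ + _); rewrite addrAC [in RHS]addrAC addrAC; congr (_ + _); rewrite addrAC.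
Qed.

Lemma ev_meet z w : ev f (diff_meet z w) = ev f z ⊓ ev f w.
Proof. by rewrite !evE bal_meetB to_balI !to_balD. Qed.

Lemma ev_join z w : ev f (diff_join z w) = ev f z ⊔ ev f w.
Proof. by rewrite !evE bal_joinB to_balU !to_balD. Qed.

Lemma ev_rho r : ev f (diff_rho r) = r •: 1.
Proof. by rewrite evE !to_bal_rho -rscaleN -rscaleDl /= opprB addrC subrK. Qed.

End Eval.
End Operations.

(** * The reflection is an object of bal *)

Section ReflectionStructure.
Variables (R : realType) (S : sbalType R).
Local Notation L := (reflection S).
Implicit Types x y : L.

Definition refl0 : L := of_diff (diff0 S).
Definition refl1 : L := of_diff (diff1 S).
(** This and the following operations compute on representatives; [evqE] gives their values under
    all morphisms, and these determine the class. *)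
Definition refl_opp x : L := of_diff (diff_opp (repr x)).
Definition refl_add x y : L := of_diff (diff_add (repr x) (repr y)).
Definition refl_mul x y : L := of_diff (diff_mul (repr x) (repr y)).
Definition refl_meet x y : L := of_diff (diff_meet (repr x) (repr y)).
Definition refl_join x y : L := of_diff (diff_join (repr x) (repr y)).
(** Scaling is multiplication by the class of a constant, as [rscalerE] has it in every target. *)
Definition refl_scale (r : R) x : L := refl_mul (of_diff (diff_rho S r)) x.
Definition refl_le x y : bool :=
  `[< forall (B : balType R) (f : sbalHom S (bal_sbal B)), evq f x ⊑ evq f y >].

Section Eval.
Variables (B : balType R) (f : sbalHom S (bal_sbal B)).

Lemma evq_refl0 : evq f refl0 = 0. Proof. by rewrite evq_of_diff ev0. Qed.
Lemma evq_refl1 : evq f refl1 = 1. Proof. by rewrite evq_of_diff ev1. Qed.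
Lemma evq_opp x : evq f (refl_opp x) = - evq f x.
Proof. by rewrite evq_of_diff ev_opp. Qed.
Lemma evq_add x y : evq f (refl_add x y) = evq f x + evq f y.
Proof. by rewrite evq_of_diff ev_add. Qed.
Lemma evq_mul x y : evq f (refl_mul x y) = evq f x * evq f y.
Proof. by rewrite evq_of_diff ev_mul. Qed.
Lemma evq_meet x y : evq f (refl_meet x y) = evq f x ⊓ evq f y.
Proof. by rewrite evq_of_diff ev_meet. Qed.
Lemma evq_join x y : evq f (refl_join x y) = evq f x ⊔ evq f y.
Proof. by rewrite evq_of_diff ev_join. Qed.
Lemma evq_scale r x : evq f (refl_scale r x) = r •: evq f x.
Proof. by rewrite evq_mul evq_of_diff ev_rho -rscalerE. Qed.

End Eval.

Definition evqE := (evq_refl0, evq_refl1, evq_opp, evq_add, evq_mul, evq_meet,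
  evq_join, evq_scale).

Lemma refl_addA : associative refl_add.
Proof. by move=> x y z; apply: evq_inj => B f; rewrite !evqE addrA. Qed.
Lemma refl_addC : commutative refl_add.
Proof. by move=> x y; apply: evq_inj => B f; rewrite !evqE addrC. Qed.
Lemma refl_add0 : left_id refl0 refl_add.
Proof. by move=> x; apply: evq_inj => B f; rewrite !evqE add0r. Qed.
Lemma refl_addN : left_inverse refl0 refl_opp refl_add.
Proof. by move=> x; apply: evq_inj => B f; rewrite !evqE addNr. Qed.
Lemma refl_mulA : associative refl_mul.
Proof. by move=> x y z; apply: evq_inj => B f; rewrite !evqE mulrA. Qed.
Lemma refl_mulC : commutative refl_mul.
Proof. by move=> x y; apply: evq_inj => B f; rewrite !evqE mulrC. Qed.
Lemma refl_mul1 : left_id refl1 refl_mul.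
Proof. by move=> x; apply: evq_inj => B f; rewrite !evqE mul1r. Qed.
Lemma refl_mulDl : left_distributive refl_mul refl_add.
Proof. by move=> x y z; apply: evq_inj => B f; rewrite !evqE mulrDl. Qed.

HB.instance Definition _ := GRing.isZmodule.Build L
  refl_addA refl_addC refl_add0 refl_addN.
HB.instance Definition _ := GRing.Zmodule_isComPzRing.Build L
  refl_mulA refl_mulC refl_mul1 refl_mulDl.

Lemma refl_lexx : reflexive refl_le.
Proof. by move=> x; apply/asboolP => B f; exact: latlexx. Qed.
Lemma refl_le_anti : antisymmetric refl_le.
Proof.
move=> x y /andP[/asboolP xy /asboolP yx]; apply: evq_inj => B f.
by apply: latle_anti; rewrite xy yx.
Qed.
Lemma refl_le_trans : transitive refl_le.
Proof.
move=> y x z /asboolP xy /asboolP yz; apply/asboolP => B f.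
exact: latle_trans (xy B f) (yz B f).
Qed.
Lemma refl_lexI x y z : refl_le x (refl_meet y z) = refl_le x y && refl_le x z.
Proof.
apply/asboolP/andP => [h|[/asboolP xy /asboolP xz] B f]; last first.
  by rewrite evqE latlexI xy xz.
by split; apply/asboolP => B f; move: (h B f); rewrite evqE latlexI => /andP[].
Qed.
Lemma refl_leUx x y z : refl_le (refl_join x y) z = refl_le x z && refl_le y z.
Proof.
apply/asboolP/andP => [h|[/asboolP xz /asboolP yz] B f]; last first.
  by rewrite evqE latleUx xz yz.
by split; apply/asboolP => B f; move: (h B f); rewrite evqE latleUx => /andP[].
Qed.

HB.instance Definition _ := Choice_isLatOrdered.Build L
  refl_lexx refl_le_anti refl_le_trans refl_lexI refl_leUx.

Lemma reflectionP x y : reflect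
  (forall (B : balType R) (f : sbalHom S (bal_sbal B)), evq f x ⊑ evq f y) (x ⊑ y).
Proof. exact: asboolP. Qed.

(** From here to [evqN], the rules for [evq] are restated for the operations of the ring instance,
    with which they agree by conversion. *)
Lemma evqD (B : balType R) (f : sbalHom S (bal_sbal B)) x y :
  evq f (x + y) = evq f x + evq f y.
Proof. exact: evq_add. Qed.
Lemma evq0 (B : balType R) (f : sbalHom S (bal_sbal B)) : evq f 0 = 0.
Proof. exact: evq_refl0. Qed.
Lemma evq1 (B : balType R) (f : sbalHom S (bal_sbal B)) : evq f 1 = 1.
Proof. exact: evq_refl1. Qed.
Lemma evqM (B : balType R) (f : sbalHom S (bal_sbal B)) x y :
  evq f (x * y) = evq f x * evq f y.
Proof. exact: evq_mul. Qed.
Lemma evqN (B : balType R) (f : sbalHom S (bal_sbal B)) x :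
  evq f (- x) = - evq f x.
Proof. exact: evq_opp. Qed.

Lemma refl_lerD2r x y z : x ⊑ y -> x + z ⊑ y + z.
Proof.
move=> /reflectionP h; apply/reflectionP => B f; rewrite !evqD.
exact: lring_lerD2r _ _ _ (h B f).
Qed.
Lemma refl_mulr_ge0 x y : 0 ⊑ x -> 0 ⊑ y -> 0 ⊑ x * y.
Proof.
move=> /reflectionP x0 /reflectionP y0; apply/reflectionP => B f.
rewrite evqM evq0; apply: lring_mulr_ge0.
  by rewrite -(evq0 f) x0.
by rewrite -(evq0 f) y0.
Qed.

HB.instance Definition _ := ComPzRing_LatOrdered_isLRing.Build L
  refl_lerD2r refl_mulr_ge0.

Lemma refl_scaleA r s x : refl_scale r (refl_scale s x) = refl_scale (r * s) x.
Proof. by apply: evq_inj => B f; rewrite !evqE rscaleA. Qed.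
Lemma refl_scale1 x : refl_scale 1 x = x.
Proof. by apply: evq_inj => B f; rewrite !evqE rscale1. Qed.
Lemma refl_scaleDr r x y : refl_scale r (x + y) = refl_scale r x + refl_scale r y.
Proof. by apply: evq_inj => B f; rewrite !evqE rscaleDr. Qed.
Lemma refl_scaleDl r s x : refl_scale (r + s) x = refl_scale r x + refl_scale s x.
Proof. by apply: evq_inj => B f; rewrite !evqE rscaleDl. Qed.
Lemma refl_scaleAl r x y : refl_scale r (x * y) = refl_scale r x * y.
Proof. by apply: evq_inj => B f; rewrite !evqE rscaleAl. Qed.
Lemma refl_scale_ge0 r x : 0 ⊑ x -> 0 <= r -> 0 ⊑ refl_scale r x.
Proof.
move=> /reflectionP x0 r0; apply/reflectionP => B f.
by rewrite evqE evq0; apply: rscale_ge0 => //; rewrite -(evq0 f) x0.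
Qed.

HB.instance Definition _ := LRing_isLOrderAlgebra.Build R L
  refl_scaleA refl_scale1 refl_scaleDr refl_scaleDl refl_scaleAl refl_scale_ge0.

Lemma evq_mulrn (B : balType R) (f : sbalHom S (bal_sbal B)) x n :
  evq f (x *+ n) = evq f x *+ n.
Proof. by elim: n => [|n IH]; rewrite ?mulr0n ?evq0// !mulrS evqD IH. Qed.

Lemma refl_bounded : lring_bounded L.
Proof.
move=> x; have [r [r0 _ ar]] := sbal_bounded (val (repr x).1).
have [s [s0 _ bs]] := sbal_bounded (val (repr x).2).
(* [x] is a difference of positive elements bounded by [r] and [s]: the first bounds [x] above, the
   second bounds it below, and [n] exceeds both. *)
pose n := Num.bound (r + s).
have rsn : r + s <= n%:R by apply/ltW/archi_boundP/addr_ge0.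
have rn : r <= n%:R by apply: le_trans rsn; rewrite lerDl.
have sn : s <= n%:R by apply: le_trans rsn; rewrite lerDr.
have nat_evq (B : balType R) (f : sbalHom S (bal_sbal B)) : evq f n%:R = n%:R.
  by rewrite evq_mulrn evq1.
exists n; split; apply/reflectionP => B f.
  rewrite evqN nat_evq; apply: bal_le_sub; last exact: to_bal_le_natr sn bs.
  by rewrite -(to_bal0 f); apply: to_bal_le; exact: valP.
rewrite nat_evq; apply: bal_sub_le; first exact: to_bal_le_natr rn ar.
by rewrite -(to_bal0 f); apply: to_bal_le; exact: valP.
Qed.

Lemma refl_archimedean : lring_archimedean L.
Proof.
move=> x y h; apply/reflectionP => B f; rewrite evq0.
apply: (@bal_archimedean R B _ (evq f y)) => n; rewrite -evq_mulrn.
by move/reflectionP: (h n) => /(_ B f).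
Qed.

HB.instance Definition _ := LOrderAlgebra_isBal.Build R L
  refl_bounded refl_archimedean.

End ReflectionStructure.

(** * The unit and the factorization through it *)

Section Unit.
Variables (R : realType) (S : sbalType R).

Definition refl_obj : balType R := reflection S.

(** The factorization of [f] through the unit; the equation is [evq_unit]. *)
Definition evq_hom (B : balType R) (f : sbalHom S (bal_sbal B)) :
  balHom refl_obj B :=
  @BalHom R refl_obj B (evq f) (evq_add f) (fun r x => evq_scale f r x)
    (evq_refl1 f) (evq_mul f) (evq_meet f) (evq_join f).

Definition shift (a : S) : nneg R := projT1 (cid (sbal_shift a)).
Definition shift_ge0 (a : S) : 0 ⊑ a + rho (val (shift a)) :=
  projT2 (cid (sbal_shift a)).

(** Formal differences have positive components, so [a] is represented as [(a + s) - s] with a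
    constant [s]. *)
Definition refl_unit (a : S) : reflection S :=
  of_diff (NNeg (shift_ge0 a), nneg_map rho_lmonoid (shift a)).

Lemma evq_unit (B : balType R) (f : sbalHom S (bal_sbal B)) (a : S) :
  evq f (refl_unit a) = to_bal f a.
Proof. by rewrite evq_of_diff evE to_balD /= addrK. Qed.

Lemma refl_unit_lmonoid : @lmonoid_morphism S (bal_sbal refl_obj) refl_unit.
Proof.
split=> a b; apply: evq_inj => B f; rewrite evq_unit.
- by rewrite evq_add !evq_unit to_balD.
- by rewrite evq_meet !evq_unit to_balI.
- by rewrite evq_join !evq_unit to_balU.
Qed.

Lemma refl_unit1 : refl_unit (val (nneg_one : nneg S)) = 1.
Proof. by apply: evq_inj => B f; rewrite evq_unit to_bal1 evq1. Qed.

Lemma refl_unitM (a b : nneg S) :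
  refl_unit (val (nneg_mul a b)) = refl_unit (val a) * refl_unit (val b).
Proof. by apply: evq_inj => B f; rewrite evqM !evq_unit to_balM. Qed.

Lemma refl_unitZ (r : nneg R) (a : S) :
  refl_unit (act r a) = val r •: (refl_unit a : refl_obj).
Proof. by apply: evq_inj => B f; rewrite evq_scale !evq_unit to_bal_act. Qed.

Definition refl_unit_hom : sbalHom S (bal_sbal refl_obj).
Proof.
apply: (@SBalHom R S (bal_sbal refl_obj) refl_unit refl_unit_lmonoid).
- exact: refl_unit1.
- by move=> a b; apply/val_inj; exact: refl_unitM.
- by move=> r a; rewrite bal_actE; exact: refl_unitZ.
Defined.

(** The image of the unit generates the reflection as a group; hence factorizations through the unit
    are unique. *)
Lemma reflection_split (x : reflection S) :
  x = refl_unit (val (repr x).1) - refl_unit (val (repr x).2).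
Proof.
by apply: evq_inj => B f; rewrite evqD evqN !evq_unit.
Qed.

End Unit.

Lemma balHomB (R : realType) (A B : balType R) (g : balHom A B) (a b : A) :
  g (a - b) = g a - g b.
Proof. by apply: (@addIr _ (g b)); rewrite -bal_additive !subrK. Qed.

(** * Functoriality and the adjunction *)

Section Functor.
Variable R : realType.

Section Map.
Variables (S T : sbalType R) (h : sbalHom S T).

Definition diff_map (z : formal_diff S) : formal_diff T :=
  (nneg_map (sbal_lmonoid h) z.1, nneg_map (sbal_lmonoid h) z.2).

Definition refl_map (x : reflection S) : reflection T := of_diff (diff_map (repr x)).

(** Evaluating after [refl_map] is evaluating at a composite, so [refl_map] inherits its properties
    from the evaluations. *)
Lemma evq_map (B : balType R) (f : sbalHom T (bal_sbal B)) (x : reflection S) :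
  evq f (refl_map x) = evq (sbal_comp f h) x.
Proof. exact: evq_of_diff. Qed.

Definition refl_map_hom : balHom (refl_obj S) (refl_obj T).
Proof.
apply: (@BalHom R _ _ refl_map) => [x y|r x||x y|x y|x y];
  apply: evq_inj => B f; rewrite ?evq_map.
- by rewrite !evq_add !evq_map.
- by rewrite !evq_scale evq_map.
- by rewrite !evq_refl1.
- by rewrite !evq_mul !evq_map.
- by rewrite !evq_meet !evq_map.
- by rewrite !evq_join !evq_map.
Defined.

Lemma refl_map_unit (a : S) : refl_map (refl_unit a) = refl_unit (h a).
Proof. by apply: evq_inj => B f; rewrite evq_map !evq_unit. Qed.

End Map.

Definition refl_functor : functor (sbal R) (bal R).
Proof.
apply: (@Functor (sbal R) (bal R) (@refl_obj R) refl_map_hom) => [S|S T U g f].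
  by apply: balHom_eq => x; apply: evq_inj => B f; rewrite [LHS]evq_map.
by apply: balHom_eq => x; apply: evq_inj => B k; rewrite /= !evq_map.
Defined.

Definition refl_transpose (S : sbal R) (B : bal R)
    (g : mor (refl_functor S) B) : mor S (bal_to_sbal R B) :=
  sbal_comp (bal_sbal_hom g) (refl_unit_hom S).

Lemma refl_transpose_bij (S : sbal R) (B : bal R) :
  bijective (@refl_transpose S B).
Proof.
exists (@evq_hom R S B) => [g|f].
  (* Once [x] is split, both sides are by conversion the same difference of values of [g] on the
     image of the unit. *)
  apply: balHom_eq => x /=; rewrite [x in RHS]reflection_split balHomB.
  by [].
by apply: sbalHom_eq => a /=; exact: evq_unit.
Qed.

Lemma refl_adjunction : adjunction refl_functor (bal_to_sbal R).
Proof.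
apply: (@Adjunction _ _ refl_functor (bal_to_sbal R) refl_transpose
  refl_transpose_bij) => [S' S B g h|S B B' k g].
  by apply: sbalHom_eq => a /=; rewrite refl_map_unit.
exact: sbalHom_eq.
Qed.

End Functor.

Theorem theorem3p14 (R : realType) : full_reflective_subcategory (bal_to_sbal R).
Proof.
split; first exact: bal_to_sbal_embedding.
  move=> A B g; exact: bal_sbal_full.
by exists (refl_functor R); constructor; exact: refl_adjunction.
Qed.
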